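(* Let $n\geq 2$ be an integer and let $k\in\{1,\dots,n-1\}$. Then there exists a constant $c(k,n)$, depending only on $k$ and $n$, such that for every real $\alpha>1$ and every positive integer $T$, $$\mathrm{Prob}(L_T\geq\alpha)\leq c(k,n)\,\alpha^{-k}.$$
   Context: For a positive integer $T$, $G(T)=\{a=(a_1,\dots,a_n)\in\mathbb{Z}_{>0}^n : \gcd(a_1,\dots,a_n)=1,\ \max_i a_i\leq T\}$, a finite nonempty set. $\mathrm{Prob}$ is the uniform probability measure on $G(T)$: the probability of an event is the number of $a\in G(T)$ satisfying it divided by $\#G(T)$. The random variable $L_T:G(T)\to\mathbb{R}_{>0}$ is $$L_T(a)=\frac{\frac1n\sum_{i=1}^n a_i}{\left(\prod_{i=1}^n a_i\right)^{1/n}}.$$ *)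

(* Defs.v *)
From HB Require Import structures.
From mathcomp Require Import all_boot all_order all_algebra.
From mathcomp Require Import reals exp.
Set Implicit Arguments.
Unset Strict Implicit.
Unset Printing Implicit Defensive.
Import Order.TTheory GRing.Theory Num.Theory.
Local Open Scope ring_scope.

(* The bound max_i a_i <= T is carried by the type of the entries: an element
   of 'I_T.+1 is a natural number that is at most T. *)
Definition G (n T : nat) : {set {ffun 'I_n -> 'I_T.+1}} :=
  [set a : {ffun 'I_n -> 'I_T.+1} |
    [forall i, 0 < a i]%N && (\big[gcdn/0]_(i < n) (a i : nat) == 1)%N].

(* The event E is only looked at on G n T. *)
Definition Prob (R : realType) (n T : nat)
    (E : pred {ffun 'I_n -> 'I_T.+1}) : R :=
  #|[set a in G n T | E a]|%:R / #|G n T|%:R.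
Arguments Prob R {n T} E.

(* Arithmetic mean over geometric mean; "`^" is the real power. *)
Definition L (R : realType) (n T : nat) (a : {ffun 'I_n -> 'I_T.+1}) : R :=
  (n%:R^-1 * \sum_(i < n) (a i : nat)%:R) /
  (\prod_(i < n) (a i : nat)%:R) `^ (n%:R^-1).
Arguments L R {n T} a.

Lemma G_neq0 (n T : nat) : (0 < n)%N -> (0 < T)%N -> G n T != set0.
Proof.
move=> n0 T0; have T1 : (1 < T.+1)%N by [].
apply/set0Pn; exists [ffun=> Ordinal T1]; rewrite inE; apply/andP; split.
  by apply/forallP => i; rewrite ffunE.
rewrite -dvdn1; apply: (@biggcdn_inf _ (Ordinal n0)) => //.
by rewrite ffunE.
Qed.

(* Main.v *)
Require Import Defs.
From HB Require Import structures.
From mathcomp Require Import all_boot all_order all_algebra.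
From mathcomp Require Import reals exp.
From mathcomp Require Import ring lra.
Import Order.TTheory GRing.Theory Num.Theory.
Local Open Scope ring_scope.

(** The tail bound is Markov's inequality for the [k]-th moment of [L], so it
    suffices that this moment is bounded independently of [T].

    The arithmetic mean is at most [T]; hence [L a ^ k] is at most
    [T ^ k] times the product of the [a_i ^ (- k / n)].  Summed over the whole
    box [[1, T]^n], which contains [G n T], the product splits into the [n]-th
    power of a one-dimensional sum.  Because [k / n < 1], that sum is still
    governed by its upper end: it is at most [n * T ^ (1 - k / n)]
    ([sum_root_pow_le]).  The powers of [T] then combine to
    [T ^ k * T ^ (n - k) = T ^ n], and the sum of [L ^ k] over [G n T] is at
    most [n ^ n * T ^ n] ([sum_L_pow_le]).

    On the other side, [G n T] fills a positive proportion of the box: a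
    positive vector that is not primitive has all its entries divisible by some
    [d >= 2], and the vectors of multiples of [d] are a proportion at most
    [d ^ -2] of the box, so that all of them together take up at most two
    thirds of it ([expr_le_card_G]).  This gives the constant [3 * n ^ n]. *)

(** [d = 1] gives the whole box of positive vectors. *)
Definition multiples (n T d : nat) : {set {ffun 'I_n -> 'I_T.+1}} :=
  [set a : {ffun 'I_n -> 'I_T.+1} | [forall i, (0 < a i)%N && (d %| a i)%N]].

Lemma card_multiples (n T d : nat) : #|multiples n T d| = ((T %/ d) ^ n)%N.
Proof.
rewrite -[n in RHS]card_ord divn_count_dvd big_add1 /= big_mkord.
set D := [pred x : 'I_T.+1 | (0 < x)%N && (d %| x)%N].
have -> : (\sum_(i < T) (d %| i.+1))%N = #|D|.
  rewrite -sum1_card [RHS]big_mkcond /= [RHS]big_ord_recl /= add0n.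
  by apply: eq_bigr => i _; rewrite inE /= /bump /= add1n; case: (d %| _)%N.
rewrite -card_ffun_on; apply: eq_card => a; rewrite inE.
by apply/forallP/ffun_onP => h i; have := h i; rewrite ?inE.
Qed.

(** Union bound over the gcd: a positive vector outside [G n T] is counted by
    [multiples n T d] for [d] its gcd, which lies between 2 and [T]. *)
Lemma expn_le_card_G_add_sum (n T : nat) : (0 < n)%N ->
  (T ^ n <= #|G n T| + \sum_(2 <= d < T.+1) (T %/ d) ^ n)%N.
Proof.
move=> n0; rewrite -{1}(divn1 T) -card_multiples.
under eq_bigr do rewrite -card_multiples -sum1_card big_mkcond /=.
rewrite exchange_big /= -!sum1_card big_mkcond /= [X in (_ <= X + _)%N]big_mkcond /=.
rewrite -big_split /=; apply: leq_sum => a _; case: ifP => // aP.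
have a0 i : (0 < a i)%N by move: aP; rewrite inE => /forallP/(_ i)/andP[].
case: ifP => // aG; rewrite add0n.
set g := (\big[gcdn/0]_(i < n) (a i : nat))%N.
have ga i : (g %| a i)%N by exact: biggcdn_inf.
have g1 : g != 1%N.
  by apply: contraFN aG => g1; rewrite inE g1 andbT; apply/forallP.
have gT : (2 <= g <= T)%N.
  have ga0 := ga (Ordinal n0); have gle := dvdn_leq (a0 _) ga0.
  rewrite (leq_trans gle) ?leq_ord // andbT.
  by move: g1 (dvdn_gt0 (a0 _) ga0); case: (g) => [|[|]].
(* The summand [d = g] alone accounts for [a]. *)
rewrite (big_rem g) /=; last by rewrite mem_index_iota ltnS.
rewrite inE; case: forallP => // -[] i; by rewrite a0 ga.
Qed.

(** Compared with a telescoping sum, as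
    [d ^ -2 <= (d - 1/2) ^ -1 - (d + 1/2) ^ -1].  All that matters later is that
    the bound is less than 1; comparing with [(d - 1) ^ -1 - d ^ -1] would only
    give 1. *)
Lemma sum_inv_sq_from2_le (R : realFieldType) (m : nat) :
  \sum_(2 <= d < m.+2) (d%:R ^- 2 : R) <= 2 / 3.
Proof.
(* The telescoped form: [2 / (2 * m + 3)] is [(d + 1/2) ^ -1] at the last
   index, [d = m + 1]. *)
suff: \sum_(2 <= d < m.+2) (d%:R ^- 2 : R) <= 2 / 3 - 2 / (2 * m%:R + 3).
  move=> /le_trans -> //; rewrite gerBl divr_ge0 //.
  by rewrite addr_ge0 ?mulr_ge0.
elim: m => [|m IH]; first by rewrite big_geq // mulr0 add0r subrr.
rewrite big_nat_recr //= (le_trans (lerD IH (lexx _))) //.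
rewrite -[m.+2%:R]natr1 -[m.+1%:R]natr1; have: 0 <= m%:R :> R by [].
move: (m%:R : R) => x x0.
rewrite -subr_ge0.
have -> : 2 / 3 - 2 / (2 * (x + 1) + 3) - (2 / 3 - 2 / (2 * x + 3) + (x + 1 + 1) ^- 2)
  = ((2 * x + 5) * (2 * x + 3) * (x + 2) ^+ 2)^-1 :> R.
  by field; apply/and3P; split; apply: lt0r_neq0; lra.
by rewrite invr_ge0 !mulr_ge0 ?exprn_ge0; lra.
Qed.

(** The hypothesis [2 <= n] is what makes the sum over [d] converge: each
    [(T %/ d) ^ n] is at most [T ^ n / d ^ 2]. *)
Lemma expr_le_card_G (R : realFieldType) (n T : nat) : (2 <= n)%N ->
  T%:R ^+ n <= 3 * #|G n T|%:R :> R.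
Proof.
move=> n2; have := @expn_le_card_G_add_sum n T (ltnW n2).
rewrite -(ler_nat R) natrD natrX natr_sum => h.
suff: \sum_(2 <= d < T.+1) ((T %/ d) ^ n)%:R <= 2 / 3 * T%:R ^+ n :> R by lra.
case: T {h} => [|T]; first by rewrite big_geq // !mulr_ge0 ?invr_ge0 ?exprn_ge0.
rewrite (le_trans _ (ler_wpM2r _ (sum_inv_sq_from2_le R T))) ?exprn_ge0 //.
rewrite mulr_suml; apply: ler_sum_nat => d /andP[d2 _].
have d0 : 0 < d%:R :> R by rewrite ltr0n (leq_trans _ d2).
have d1 : 1 <= d%:R :> R by rewrite ler1n (leq_trans _ d2).
rewrite natrX (@le_trans _ _ ((T.+1%:R / d%:R) ^+ n)) //.
  rewrite lerXn2r ?nnegrE ?divr_ge0 // ler_pdivlMr // -natrM ler_nat.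
  exact: leq_trunc_div.
rewrite expr_div_n mulrC ler_wpM2r ?exprn_ge0 //.
by rewrite lef_pV2 ?posrE ?exprn_gt0 // ler_weXn2l.
Qed.

(** With [r j] the [n]-th root of [j], this bounds the sum of the
    [j ^ (- k / n)] by [n * T ^ (1 - k / n)]; working with roots keeps all
    exponents natural.  The term [j = 0] vanishes because the inverse of 0
    is 0.  The inductive step compares two differences between consecutive roots
    [x <= y]: as [y ^ n - x ^ n = 1], the gap [y - x] is at least
    [1 / (n * y ^ (n - 1))], and [y ^ (n - k) - x ^ (n - k)] is at least
    [(y - x) * y ^ (n - k - 1)]. *)
Lemma sum_root_pow_le (R : realFieldType) (n k : nat) (r : nat -> R) :
  (0 < k < n)%N -> (forall j, 0 <= r j) -> (forall j, r j ^+ n = j%:R) ->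
  forall T, \sum_(j < T.+1) r j ^- k <= n%:R * r T ^+ (n - k).
Proof.
move=> /andP[k0 kn] r0 rn.
have r00 : r 0%N = 0.
  by apply/eqP; have := rn 0%N => /eqP; rewrite expf_eq0 => /andP[].
elim=> [|T IH].
  by rewrite big_ord_recr big_ord0 /= r00 !expr0n !gtn_eqF ?subn_gt0 // invr0 mulr0 addr0.
rewrite big_ord_recr /= (le_trans (lerD IH (lexx _))) //.
set x := r T; set y := r T.+1.
have n0 : (0 < n)%N by apply: leq_trans kn.
have y0 : 0 < y.
  rewrite lt0r r0 andbT; apply/eqP => yE; have /eqP := rn T.+1.
  by rewrite -/y yE expr0n gtn_eqF // eq_sym pnatr_eq0.
have xy : x <= y by rewrite -(@ler_pXn2r _ n) ?nnegrE ?r0 // !rn ler_nat.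
have gap : 1 <= n%:R * ((y - x) * y ^+ n.-1).
  have yx : y ^+ n - x ^+ n = 1 by rewrite !rn -natr1 addrC addKr.
  rewrite -[leLHS]yx subrXX mulrCA ler_wpM2l ?subr_ge0 //.
  rewrite mulr_natl -[n in _ *+ n]card_ord -sumr_const.
  apply: ler_sum => i _.
  have ile : (i <= n.-1)%N by rewrite -ltnS prednK.
  rewrite -[n.-1 in leRHS](subnK ile) exprD.
  by rewrite ler_wpM2l ?exprn_ge0 ?lerXn2r ?nnegrE ?r0.
have step : (y - x) * y ^+ (n - k).-1 <= y ^+ (n - k) - x ^+ (n - k).
  have -> : (n - k = (n - k).-1.+1)%N by rewrite prednK ?subn_gt0.
  rewrite /= !exprS mulrBl lerD2l lerN2.
  by rewrite ler_wpM2l ?lerXn2r ?nnegrE ?r0.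
rewrite -lerBrDl -mulrBr.
apply: le_trans (ler_wpM2l (ler0n _ n) step).
rewrite -[leLHS]mul1r ler_pdivrMr ?exprn_gt0 //.
rewrite -!mulrA -exprD.
suff -> : ((n - k).-1 + k = n.-1)%N by [].
by rewrite -(subnK (ltnW kn)) addnK -[in RHS](prednK (n:=n - k)) ?subn_gt0.
Qed.

Lemma powR_prod (R : realType) (I : finType) (f : I -> R) (s : R) :
  (forall i, 0 <= f i) -> (\prod_i f i) `^ s = \prod_i (f i `^ s).
Proof.
move=> f0; suff [] : 0 <= \prod_i f i /\ (\prod_i f i) `^ s = \prod_i (f i `^ s) by [].
apply: (big_ind2 (fun x y : R => 0 <= x /\ x `^ s = y)) => [|x _ y _ [x0 <-] [y0 <-]|//].
  by rewrite powR1.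
by rewrite mulr_ge0 // powRM.
Qed.

Lemma L_pow_le (R : realType) (n T k : nat) (a : {ffun 'I_n -> 'I_T.+1}) :
  (0 < n)%N ->
  L R a ^+ k <= T%:R ^+ k * \prod_i ((a i : nat)%:R `^ n%:R^-1) ^- k.
Proof.
move=> n0; rewrite /L powR_prod // prodfV prodrXl -expr_div_n.
rewrite lerXn2r ?nnegrE ?divr_ge0 ?mulr_ge0 ?invr_ge0 ?sumr_ge0 ?prodr_ge0 //;
  do ?[by move=> *; rewrite powR_ge0].
rewrite ler_wpM2r ?invr_ge0 ?prodr_ge0 //; first by move=> *; rewrite powR_ge0.
rewrite mulrC ler_pdivrMr ?ltr0n // mulr_natr -[n in _ *+ n]card_ord -sumr_const.
by apply: ler_sum => i _; rewrite ler_nat leq_ord.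
Qed.

(** The sum is enlarged to all functions into ['I_T.+1], so that it factors
    over the coordinates.  Functions taking the value 0 add nothing, the inverse
    of 0 being 0. *)
Lemma sum_L_pow_le (R : realType) (n T k : nat) : (0 < k < n)%N ->
  \sum_(a in G n T) L R a ^+ k <= n%:R ^+ n * T%:R ^+ n.
Proof.
move=> /[dup] kn /andP[_ kltn].
have n0 : (0 < n)%N by apply: leq_trans kltn.
pose r j : R := j%:R `^ n%:R^-1.
have r0 j : 0 <= r j by exact: powR_ge0.
have rn j : r j ^+ n = j%:R.
  by rewrite -powR_mulrn // -powRrM mulVf ?powRr1 // pnatr_eq0 -lt0n.
rewrite (@le_trans _ _ (\sum_(a : {ffun 'I_n -> 'I_T.+1}) T%:R ^+ k * \prod_i r (a i) ^- k)) //.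
  rewrite big_mkcond; apply: ler_sum => a _; case: ifP => _; first exact: L_pow_le.
  by rewrite mulr_ge0 ?exprn_ge0 ?prodr_ge0 // => i _; rewrite invr_ge0 exprn_ge0.
rewrite -mulr_sumr -(bigA_distr_bigA (fun _ (j : 'I_T.+1) => r j ^- k)) /=.
rewrite prodr_const card_ord.
have S0 : 0 <= \sum_(j < T.+1) r j ^- k.
  by apply: sumr_ge0 => j _; rewrite invr_ge0 exprn_ge0.
have := sum_root_pow_le R n k r kn r0 rn T => Sle.
rewrite (@le_trans _ _ (T%:R ^+ k * (n%:R * r T ^+ (n - k)) ^+ n)) //.
  by rewrite ler_wpM2l ?exprn_ge0 // lerXn2r ?nnegrE // mulr_ge0 ?exprn_ge0.
by rewrite exprMn exprAC rn mulrCA -exprD subnKC // ltnW.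
Qed.

Theorem theorem2 (R : realType) (n k : nat)
    (hn : (2 <= n)%N) (hk : (1 <= k <= n - 1)%N) :
  exists c : R, forall (alpha : R) (T : nat), 1 < alpha -> (0 < T)%N ->
    Prob R (fun a : {ffun 'I_n -> 'I_T.+1} => alpha <= L R a)
      <= c * alpha ^- k.
Proof.
have kn : (0 < k < n)%N by rewrite -[n](subnK (ltnW hn)) addn1 ltnS.
exists (3 * n%:R ^+ n) => alpha T a1 T0; rewrite /Prob.
have alpha0 : 0 < alpha by apply: lt_trans a1.
have G0 : 0 < #|G n T|%:R :> R.
  by rewrite ltr0n card_gt0 G_neq0 // (leq_trans _ hn).
rewrite ler_pdivrMr // mulrAC ler_pdivlMr ?exprn_gt0 //.
set E := [set _ in _ | _].
have markov : #|E|%:R * alpha ^+ k <= \sum_(a in G n T) L R a ^+ k.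
  rewrite mulr_natl -sumr_const big_mkcond [leRHS]big_mkcond /=.
  apply: ler_sum => a _; rewrite inE; case: ifP => /=; last first.
    case: ifP => // _ _; rewrite exprn_ge0 // divr_ge0 ?powR_ge0 //.
    by rewrite mulr_ge0 ?invr_ge0 ?sumr_ge0.
  move=> /andP[-> aE]; rewrite lerXn2r ?nnegrE ?(le_trans (ltW alpha0) aE) //.
  exact: ltW.
apply: (le_trans markov); apply: (le_trans (sum_L_pow_le R n T k kn)).
rewrite [3 * _]mulrC -mulrA ler_wpM2l ?exprn_ge0 //; exact: expr_le_card_G.
Qed.
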